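(* Let $A,B\in\mathbb{C}^{n\times n}$ with $\mathrm{rk}(A)=r$ and $\mathrm{rk}(B)=s$ be written as $$A=U\begin{bmatrix}\Sigma_A A_1&\Sigma_A A_2\\0&0\end{bmatrix}V^*,\qquad B=V\begin{bmatrix}\Sigma_B B_1&\Sigma_B B_2\\0&0\end{bmatrix}U^*,$$ where $U,V\in\mathbb{C}^{n\times n}$ are unitary, $\Sigma_A\in\mathbb{C}^{r\times r}$ and $\Sigma_B\in\mathbb{C}^{s\times s}$ are diagonal positive definite matrices, and the blocks $A_1\in\mathbb{C}^{r\times s}$, $A_2\in\mathbb{C}^{r\times(n-s)}$, $B_1\in\mathbb{C}^{s\times r}$, $B_2\in\mathbb{C}^{s\times(n-r)}$ satisfy $A_1A_1^*+A_2A_2^*=I_r$ and $B_1B_1^*+B_2B_2^*=I_s$. Then $$A^{(B)}=V\begin{bmatrix}(\Sigma_A A_1)^\dagger&0\\0&0\end{bmatrix}U^*.$$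
   Context: $M^*$ is the conjugate transpose, $\mathrm{rk}(M)$ the rank and $M^\dagger$ the Moore-Penrose inverse of a complex matrix $M$. For $A,B\in\mathbb{C}^{n\times n}$, the generalized inverse of $A$ with respect to $B$ is $A^{(B)}:=(ABB^\dagger)^\dagger$. *)

(* Defs.v *)
From mathcomp Require Export all_boot all_order all_algebra.
From mathcomp Require Export complex reals.

Set Implicit Arguments.
Unset Strict Implicit.
Unset Printing Implicit Defensive.

Import Order.TTheory GRing.Theory Num.Theory Num.Def.


Local Open Scope ring_scope.
Local Open Scope sesquilinear_scope.

Section MoorePenrose.
Variable C : numClosedFieldType.

Definition penrose m n (A : 'M[C]_(m, n)) (X : 'M[C]_(n, m)) : bool :=
  [&& A *m X *m A == A, X *m A *m X == X,
      (A *m X)^t* == A *m X & (X *m A)^t* == X *m A].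

Lemma adjmx_mul m n p (A : 'M[C]_(m, n)) (B : 'M[C]_(n, p)) :
  (A *m B)^t* = B^t* *m A^t*.
Proof. by rewrite trmx_mul map_mxM. Qed.

Lemma mulmx_adj_eq0 m n (A : 'M[C]_(m, n)) : A *m A^t* = 0 -> A = 0.
Proof.
move=> A0; apply/matrixP=> i j; rewrite mxE; apply/eqP.
have /eqP := congr1 (fun M : 'M[C]_m => M i i) A0; rewrite !mxE.
rewrite psumr_eq0 => [/allP/(_ j (mem_index_enum _))|k _]; rewrite !mxE.
  by rewrite mulf_eq0 conjC_eq0 orbb.
by rewrite mul_conjC_ge0.
Qed.

Lemma row_free_gram_unit m n (A : 'M[C]_(m, n)) :
  row_free A -> A *m A^t* \in unitmx.
Proof.
move=> fA; rewrite -row_free_unit -kermx_eq0; apply/eqP.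
set K := kermx _; suff KA0 : K *m A = 0.
  by apply/eqP; rewrite -(mulmx_free_eq0 K fA) KA0.
by apply: mulmx_adj_eq0; rewrite adjmx_mul mulmxA -[_ *m _ *m A^t*]mulmxA
  mulmx_ker mul0mx.
Qed.

Lemma penrose_exists m n (A : 'M[C]_(m, n)) : exists X, penrose A X.
Proof.
have [k [F [G [fF fG ->]]]] : exists k, exists F : 'M[C]_(m, k),
    exists G : 'M[C]_(k, n), [/\ row_full F, row_free G & A = F *m G].
  exists (\rank A), (col_base A), (row_base A).
  by rewrite col_base_full row_base_free mulmx_base.
pose SF := F^t* *m F; pose SG := G *m G^t*.
have uG : SG \in unitmx by apply: row_free_gram_unit.
have uF : SF \in unitmx.
  have fF' : row_free (F^t*) by rewrite /row_free mxrank_map mxrank_tr.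
  by have := row_free_gram_unit fF'; rewrite trmxCK.
have SFh : SF^t* = SF by rewrite adjmx_mul trmxCK.
have SGh : SG^t* = SG by rewrite adjmx_mul trmxCK.
pose X := G^t* *m invmx SG *m (invmx SF *m F^t*).
have AX : F *m G *m X = F *m invmx SF *m F^t*.
  by rewrite /X -!mulmxA (mulmxA G) (mulmxA SG) mulmxV // mul1mx.
have XA : X *m (F *m G) = G^t* *m invmx SG *m G.
  by rewrite /X -!mulmxA (mulmxA (F^t*)) (mulmxA (invmx SF)) mulVmx // mul1mx.
exists X; apply/and4P; split; apply/eqP.
- by rewrite AX -!mulmxA (mulmxA (F^t*)) (mulmxA (invmx SF)) mulVmx // mul1mx.
- by rewrite XA /X -!mulmxA (mulmxA G) (mulmxA SG) mulmxV // mul1mx.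
- by rewrite AX !adjmx_mul trmxCK trmx_inv map_invmx SFh mulmxA.
- by rewrite XA !adjmx_mul trmxCK trmx_inv map_invmx SGh mulmxA.
Qed.

Lemma penrose_unique m n (A : 'M[C]_(m, n)) X Y :
  penrose A X -> penrose A Y -> X = Y.
Proof.
move=> /and4P[/eqP A1 /eqP X2 /eqP X3 /eqP X4].
move=> /and4P[/eqP B1 /eqP Y2 /eqP Y3 /eqP Y4].
have AXY : A *m X = A *m Y.
  by rewrite -X3 -{1}B1 -mulmxA adjmx_mul X3 Y3 mulmxA A1.
have XAY : X *m A = Y *m A.
  by rewrite -X4 -{1}B1 !mulmxA -(mulmxA _ Y A) adjmx_mul X4 Y4 -mulmxA
    (mulmxA A) A1.
by rewrite -X2 XAY -mulmxA AXY mulmxA Y2.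
Qed.

Definition mpinv m n (A : 'M[C]_(m, n)) : 'M[C]_(n, m) :=
  xchoose (penrose_exists A).

Lemma mpinvP m n (A : 'M[C]_(m, n)) : penrose A (mpinv A).
Proof. exact: xchooseP. Qed.

Definition geninv n (A B : 'M[C]_n) : 'M[C]_n := mpinv (A *m B *m mpinv B).

Definition posdefmx n (M : 'M[C]_n) : Prop :=
  M \is hermsymmx /\
  forall v : 'cV[C]_n, v != 0 -> 0 < (v^t* *m M *m v) 0 0.

End MoorePenrose.

Lemma rank_subnKC (F : fieldType) n (A : 'M[F]_n) r :
  \rank A = r -> (r + (n - r))%N = n.
Proof. by move=> <-; rewrite subnKC // rank_leq_row. Qed.

(* The cast makes a matrix partitioned as r + (n - r) by s + (n - s) square. *)
Definition sqblock_mx (F : Type) n r s (er : (r + (n - r))%N = n)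
    (es : (s + (n - s))%N = n)
    (ul : 'M[F]_(r, s)) (ur : 'M[F]_(r, n - s))
    (dl : 'M[F]_(n - r, s)) (dr : 'M[F]_(n - r, n - s)) : 'M[F]_n :=
  castmx (er, es) (block_mx ul ur dl dr).

(* Main.v *)
Require Import Defs.
From mathcomp Require Import all_boot all_order all_algebra.
From mathcomp Require Import complex reals.

Import Order.TTheory GRing.Theory.

Local Open Scope ring_scope.
Local Open Scope complex_scope.
Local Open Scope sesquilinear_scope.

(** The matrix [B *m mpinv B] is the orthogonal projector onto the column space
of [B].  The block row [SB B1, SB B2] has full row rank: since
[B1 B1^* + B2 B2^* = 1] and [SB] is invertible, it admits the right inverse
obtained by stacking [B1^* SB^-1] on [B2^* SB^-1].  Hence the column space of
[B] is the span of the first [s] columns of [V], and the projector is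
[V diag(1, 0) V^*] (by [mulmx_mpinv_eq]).  Multiplying [A] by it on the right
erases the block [SA A2], leaving [U diag(SA A1, 0) V^*].  The Moore-Penrose
inverse commutes with unitary changes of basis and with padding by zero blocks
([mpinv_unitary], [mpinv_sqblock]), which gives the formula. *)

Section MoorePenroseComplements.
Set Implicit Arguments.
Unset Strict Implicit.
Variable C : numClosedFieldType.

Lemma mpinv_eq m n (A : 'M[C]_(m, n)) X : penrose A X -> mpinv A = X.
Proof. exact: penrose_unique (mpinvP A). Qed.

(** Both [P] and [Q := A *m mpinv A] are Hermitian and each fixes the image of
the other: [Q P = P] because [P] factors through [A], and [P Q = Q] because [P]
fixes [A].  Taking adjoints in [Q P = P] gives [P Q = P],
so [P = Q]. *)
Lemma mulmx_mpinv_eq m n (A : 'M[C]_(m, n)) (X : 'M[C]_(n, m)) P :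
  P^t* = P -> P *m A = A -> A *m X = P -> A *m mpinv A = P.
Proof.
move=> Ph PA AX; have /and4P[/eqP AYA _ /eqP Qh _] := mpinvP A.
have QP : A *m mpinv A *m P = P by rewrite -AX mulmxA AYA.
by rewrite -[RHS]Ph -[in RHS]QP adjmx_mul Qh Ph mulmxA PA.
Qed.

Lemma unitarymx_adjK n (U : 'M[C]_n) : U \is unitarymx -> U^t* *m U = 1%:M.
Proof. by move=> /unitarymxP/mulmx1C. Qed.

Lemma mpinv_unitary n (U V D : 'M[C]_n) :
  U \is unitarymx -> V \is unitarymx ->
  mpinv (U *m D *m V^t*) = V *m mpinv D *m U^t*.
Proof.
move=> /unitarymx_adjK UU /unitarymx_adjK VV; apply: mpinv_eq.
have /and4P[/eqP DXD /eqP XDX /eqP DXh /eqP XDh] := mpinvP D.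
have sandwich (P Q W X Y : 'M[C]_n) : W^t* *m W = 1%:M ->
    P *m X *m W^t* *m (W *m Y *m Q) = P *m (X *m Y) *m Q.
  by move=> WW; rewrite -!mulmxA (mulmxA (W^t*) W) WW mul1mx.
apply/and4P; split; apply/eqP; rewrite !sandwich ?DXD ?XDX //.
- by rewrite adjmx_mul trmxCK adjmx_mul DXh mulmxA.
- by rewrite adjmx_mul trmxCK adjmx_mul XDh mulmxA.
Qed.

(** The quadratic form of a positive definite matrix would vanish on a nonzero
kernel vector. *)
Lemma posdefmx_unit n (M : 'M[C]_n) : posdefmx M -> M \in unitmx.
Proof.
move=> [_ Mpos]; rewrite -unitmx_tr -row_free_unit -kermx_eq0.
apply/negPn/negP=> /rowV0Pn[v /sub_kermxP vM v0].
have Mv : M *m v^T = 0 by apply: trmx_inj; rewrite trmx_mul trmxK vM trmx0.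
have := Mpos v^T; rewrite -mulmxA Mv mulmx0 mxE ltxx.
by rewrite -(inj_eq trmx_inj) trmxK trmx0 => /(_ v0).
Qed.

End MoorePenroseComplements.

Section SquareBlocks.
Set Implicit Arguments.
Unset Strict Implicit.

Lemma mulmx_sqblock (F : pzRingType) n r s t (er : (r + (n - r))%N = n)
    (es : (s + (n - s))%N = n) (et : (t + (n - t))%N = n)
    (a : 'M[F]_(r, s)) b c d (a' : 'M[F]_(s, t)) b' c' d' :
  sqblock_mx er es a b c d *m sqblock_mx es et a' b' c' d' =
  sqblock_mx er et (a *m a' + b *m c') (a *m b' + b *m d')
                   (c *m a' + d *m c') (c *m b' + d *m d').
Proof.
have mul_cast m p q m1 p1 q1 (em : m = m1) (ep : p = p1) (eq : q = q1)
    (X : 'M[F]_(m, p)) (Y : 'M[F]_(p, q)) :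
    castmx (em, ep) X *m castmx (ep, eq) Y = castmx (em, eq) (X *m Y).
  by case: _ / em; case: _ / ep; case: _ / eq; rewrite !castmx_id.
by rewrite /sqblock_mx mul_cast mulmx_block.
Qed.

Lemma adjmx_sqblock (C : numClosedFieldType) n r s (er : (r + (n - r))%N = n)
    (es : (s + (n - s))%N = n) (a : 'M[C]_(r, s)) b c d :
  (sqblock_mx er es a b c d)^t* = sqblock_mx es er (a^t*) (c^t*) (b^t*) (d^t*).
Proof. by rewrite /sqblock_mx trmx_cast map_castmx tr_block_mx map_block_mx. Qed.

Lemma mpinv_sqblock (C : numClosedFieldType) n r s (er : (r + (n - r))%N = n)
    (es : (s + (n - s))%N = n) (M : 'M[C]_(r, s)) :
  mpinv (sqblock_mx er es M 0 0 0) = sqblock_mx es er (mpinv M) 0 0 0.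
Proof.
apply: mpinv_eq; have /and4P[/eqP a1 /eqP a2 /eqP a3 /eqP a4] := mpinvP M.
apply/and4P; split; apply/eqP;
  rewrite ?mulmx_sqblock !(mul0mx, mulmx0, addr0) ?a1 ?a2 //.
- by rewrite adjmx_sqblock a3 !trmx0 !map_mx0.
- by rewrite adjmx_sqblock a4 !trmx0 !map_mx0.
Qed.

End SquareBlocks.

Theorem theorem2p4 (R : realType) (n r s : nat) (A B : 'M[R[i]]_n)
  (hA : \rank A = r) (hB : \rank B = s)
  (U V : 'M[R[i]]_n) (SA : 'M[R[i]]_r) (SB : 'M[R[i]]_s)
  (A1 : 'M[R[i]]_(r, s)) (A2 : 'M[R[i]]_(r, n - s))
  (B1 : 'M[R[i]]_(s, r)) (B2 : 'M[R[i]]_(s, n - r))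
  (hU : U \is unitarymx) (hV : V \is unitarymx)
  (hSA : is_diag_mx SA) (hSA_pos : posdefmx SA)
  (hSB : is_diag_mx SB) (hSB_pos : posdefmx SB)
  (hA12 : A1 *m A1^t* + A2 *m A2^t* = 1%:M)
  (hB12 : B1 *m B1^t* + B2 *m B2^t* = 1%:M)
  (hAdec : A = U *m sqblock_mx (rank_subnKC hA) (rank_subnKC hB)
                      (SA *m A1) (SA *m A2) 0 0 *m V^t*)
  (hBdec : B = V *m sqblock_mx (rank_subnKC hB) (rank_subnKC hA)
                      (SB *m B1) (SB *m B2) 0 0 *m U^t*) :
  geninv A B = V *m sqblock_mx (rank_subnKC hB) (rank_subnKC hA)
                      (mpinv (SA *m A1)) 0 0 0 *m U^t*.
Proof.
have uSB := posdefmx_unit hSB_pos.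
have UU := unitarymx_adjK hU; have VV := unitarymx_adjK hV.
set er := rank_subnKC hA in hAdec hBdec *; set es := rank_subnKC hB in hAdec hBdec *.
pose E := sqblock_mx es es (1%:M : 'M[R[i]]_s) 0 0 0.
(* The first block column of [X] is the right inverse of [SB B1, SB B2]. *)
pose X := sqblock_mx er es (B1^t* *m invmx SB) 0 (B2^t* *m invmx SB) 0.
have BBp : B *m mpinv B = V *m E *m V^t*.
  apply: (@mulmx_mpinv_eq _ _ _ _ (U *m X *m V^t*)).
  - by rewrite !adjmx_mul trmxCK adjmx_sqblock trmx1 map_mx1 !trmx0 !map_mx0 mulmxA.
  - rewrite hBdec -!mulmxA (mulmxA (V^t*) V) VV mul1mx (mulmxA E) mulmx_sqblock.
    by rewrite !mul1mx !(mul0mx, mulmx0, addr0).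
  - rewrite hBdec -!mulmxA (mulmxA (U^t*) U) UU mul1mx (mulmxA _ X) mulmx_sqblock.
    rewrite !(mul0mx, mulmx0, addr0) -!mulmxA -mulmxDr !mulmxA -mulmxDl hB12.
    by rewrite mul1mx mulmxV.
have -> : geninv A B = mpinv (U *m sqblock_mx er es (SA *m A1) 0 0 0 *m V^t*).
  rewrite /geninv -mulmxA BBp hAdec -!mulmxA (mulmxA (V^t*) V) VV mul1mx.
  by rewrite (mulmxA _ E) mulmx_sqblock !(mul0mx, mulmx0, addr0) mulmx1.
by rewrite mpinv_unitary // mpinv_sqblock.
Qed.
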